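(* Given a point $(\bar{x},\bar{y}) \in X_{\rm LP}$, a basic optimal solution $(\alpha,\beta,\gamma)\in\mathbb{R}^{|Q|}\times\mathbb{R}^{|T|}\times\mathbb{R}$ of the linear programming problem $$\max_{\alpha,\beta,\gamma}\ \bar{x}^{\top}\alpha-\bar{y}^{\top}\beta-\gamma\quad\text{s.t.}\quad (x^k)^{\top}\alpha-(y^k)^{\top}\beta-\gamma\le 0\ (k=1,\ldots,u),\quad \beta_1=1,\quad \beta_t\ge 0\ (t\in T\setminus\{1\}),$$ where $(x^1,y^1),\ldots,(x^u,y^u)$ are the vertices of $P$, defines a facet-defining inequality $\alpha^{\top}x\le\beta^{\top}y+\gamma$ of the polyhedron $P$.
   Context: $Q$ is a finite set, $T=\{1,\ldots,|T|\}\ne\varnothing$, $0<b_1\le\cdots\le b_{|T|}$ are real numbers, $a_q>0$ for all $q\in Q$, $c\in\mathbb{R}$, and $\sum_{q\in Q}a_q-c>0$. The unsplittable flow arc-set is $$X=\Big\{(x,y)\in\{0,1\}^{|Q|}\times\mathbb{Z}_+^{|T|}:\ \sum_{q\in Q}a_qx_q\le\sum_{t\in T}b_ty_t+c\Big\},$$ $P=\mathrm{conv}(X)$ is the unsplittable flow arc-set polyhedron, and $X_{\rm LP}=\{(x,y)\in[0,1]^{|Q|}\times\mathbb{R}_+^{|T|}:\sum_{q\in Q}a_qx_q\le\sum_{t\in T}b_ty_t+c\}$ is the linear relaxation of $X$. A basic optimal solution is an optimal solution at which the coefficient vectors of the active constraints (including $\beta_1=1$) have rank $|Q|+|T|+1$,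 the number of variables. *)

(* Defs.v *)
From mathcomp Require Import all_boot all_order all_algebra.
From mathcomp Require Import boolp classical_sets reals convex.

Set Implicit Arguments.
Unset Strict Implicit.
Unset Printing Implicit Defensive.

Import Order.TTheory GRing.Theory Num.Theory.

Local Open Scope classical_set_scope.
Local Open Scope ring_scope.

Section VectorSets.
Context {R : realType} {V : vectType R}.
Implicit Types (A : set V) (s : seq V).

Definition convex_hull A : set V := smallest (@convex_set R V) A.

Definition extreme_point A : set V :=
  [set v | A v /\ forall (p q : V) (t : R), A p -> A q -> 0 < t < 1 ->
                    v = t *: p + (1 - t) *: q -> p = q].

Definition has_rank A (r : nat) : Prop :=
  (exists s, [/\ free s, [set` s] `<=` A & size s = r]) /\
  (forall s, free s -> [set` s] `<=` A -> (size s <= r)%N).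

Definition affinely_independent s : Prop :=
  forall k : 'I_(size s) -> R,
    \sum_(i < size s) k i *: s`_i = 0 -> \sum_(i < size s) k i = 0 ->
    forall i, k i = 0.

(* Largest number of affinely independent points, minus one; an integer
   because the empty set has dimension -1. *)
Definition has_dim A (d : int) : Prop :=
  (exists s, [/\ affinely_independent s, [set` s] `<=` A
               & (size s)%:Z = d + 1]) /\
  (forall s, affinely_independent s -> [set` s] `<=` A ->
     (size s)%:Z <= d + 1).

End VectorSets.

Definition dot {R : realType} {I : finType} (u v : {ffun I -> R^o}) : R :=
  \sum_i u i * v i.

(* [R^o] is [R] as a vector space over itself, which makes these product spaces
   [vectType]s.  The index set T = {1, ..., |T|} is ['I_n.+1] with |T| = n.+1,
   and its element 1 is [ord0]. *)
Notation flow_point R Q n :=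
  ({ffun Q -> R^o} * {ffun 'I_n.+1 -> R^o})%type.
Notation lp_vector R Q n :=
  ({ffun Q -> R^o} * {ffun 'I_n.+1 -> R^o} * R^o)%type.

Section FlowArcSet.
Context {R : realType} {Q : finType} {n : nat}.
Variables (a : {ffun Q -> R^o}) (b : {ffun 'I_n.+1 -> R^o}) (c : R).

Definition flow_arc_set : set (flow_point R Q n) :=
  [set p : flow_point R Q n |
           [/\ forall q, p.1 q = 0 \/ p.1 q = 1,
               forall t, (p.2 t : R) \is a Num.nat
             & dot a p.1 <= dot b p.2 + c]].

Definition flow_arc_relaxation : set (flow_point R Q n) :=
  [set p : flow_point R Q n |
           [/\ forall q, 0 <= p.1 q <= 1,
               forall t, 0 <= p.2 t
             & dot a p.1 <= dot b p.2 + c]].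

Definition flow_arc_polyhedron : set (flow_point R Q n) :=
  convex_hull flow_arc_set.

End FlowArcSet.

Section Inequality.
Context {R : realType} {Q : finType} {n : nat}.
Variables (P : set (flow_point R Q n)) (alpha : {ffun Q -> R^o})
  (beta : {ffun 'I_n.+1 -> R^o}) (gamma : R).

Definition valid_inequality : Prop :=
  forall p, P p -> dot alpha p.1 <= dot beta p.2 + gamma.

Definition induced_face : set (flow_point R Q n) :=
  [set p : flow_point R Q n | P p /\ dot alpha p.1 = dot beta p.2 + gamma].

Definition facet_defining : Prop :=
  [/\ valid_inequality, induced_face !=set0
    & exists d : int, has_dim P d /\ has_dim induced_face (d - 1)].

(* The maximization over (alpha, beta, gamma) has one constraint per vertex of
   [P]; the vertices are taken as a set, with no finiteness hypothesis. *)
Definition lp_feasible : Prop :=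
  [/\ forall v, extreme_point P v ->
        dot v.1 alpha - dot v.2 beta - gamma <= 0,
      beta ord0 = 1
    & forall t, t != ord0 -> 0 <= beta t].

(* Coefficient vectors, in the variables (alpha, beta, gamma), of the active
   constraints; the equation beta_1 = 1 counts as always active. *)
Definition lp_active : set (lp_vector R Q n) :=
  [set (v.1, - v.2, -1) | v in
     [set v : flow_point R Q n |
       extreme_point P v /\ dot v.1 alpha - dot v.2 beta - gamma = 0]]
  `|` [set (0, [ffun s => (s == ord0)%:R], 0)]
  `|` [set (0, [ffun s => (s == t)%:R], 0) | t in
     [set t : 'I_n.+1 | t != ord0 /\ beta t = 0]].

End Inequality.

Definition lp_objective {R : realType} {Q : finType} {n : nat}
    (p : flow_point R Q n) (alpha : {ffun Q -> R^o}) (beta : {ffun 'I_n.+1 -> R^o})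
    (gamma : R) : R :=
  dot p.1 alpha - dot p.2 beta - gamma.

Definition lp_optimal {R : realType} {Q : finType} {n : nat}
    (P : set (flow_point R Q n)) (p : flow_point R Q n) (alpha : {ffun Q -> R^o})
    (beta : {ffun 'I_n.+1 -> R^o}) (gamma : R) : Prop :=
  lp_feasible P alpha beta gamma /\
  forall alpha' beta' gamma', lp_feasible P alpha' beta' gamma' ->
    lp_objective p alpha' beta' gamma' <= lp_objective p alpha beta gamma.

Definition lp_basic_optimal {R : realType} {Q : finType} {n : nat}
    (P : set (flow_point R Q n)) (p : flow_point R Q n) (alpha : {ffun Q -> R^o})
    (beta : {ffun 'I_n.+1 -> R^o}) (gamma : R) : Prop :=
  lp_optimal P p alpha beta gamma /\
  has_rank (lp_active P alpha beta gamma) (#|Q| + n.+1 + 1).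

(* Main.v *)
Require Import Defs.
From mathcomp Require Import all_boot all_order all_algebra.
From mathcomp Require Import boolp classical_sets reals convex.
From HB Require Import structures.
From mathcomp Require Import interval_inference ring lra.

(** Two facts carry the proof: every feasible point of the linear program is a
    valid inequality for P, and a basic one is tight on enough points of P to
    span a hyperplane.

    Validity ([lp_feasible_valid]).  Feasibility bounds the functional
    (alpha, -beta) by gamma at the vertices only, and P is unbounded, so it has
    to be shown that vertices control the whole of P.  When every beta_t is
    positive, only finitely many points of X have a functional value above a
    given level ([flow_arc_bounded]), so the maximum over X is attained.  Among
    the maximizers, one of largest Euclidean norm is a vertex, because the
    squared norm is strictly convex ([extreme_point_lexmax]); hence every point of X is
    dominated by a vertex ([dominating_vertex]).  When some beta_t vanish, beta
    is replaced by beta + eps * (1, ..., 1) and eps is made small.  This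
    perturbation takes the place of the decomposition of P into the hull of its vertices
    plus its recession cone.

    Dimension ([facet_dimensions]).  Write row(v) = (x, -y, -1) for the constraint
    coefficients of a point v = (x, y).  Points are affinely independent exactly
    when their rows are linearly independent.  The active coefficient vectors
    are rows of vertices on the face F, the vector e_1 of the normalization
    beta_1 = 1, and vectors e_t with beta_t = 0.  In the last case moving a
    point v of F by one unit of y_t stays in F, and
    e_t = row(v) - row(v + e_t), so e_t lies in the span of the rows of F
    ([active_subset_face_span]).  Thus e_1 and the rows of F span the whole space,
    of dimension |Q| + |T| + 1.  The left-hand side of the constraints, viewed as
    a linear functional, vanishes on the rows of F but equals beta_1 = 1 at e_1,
    so the rows of F span a space of dimension exactly |Q| + |T|, and dim F =
    |Q| + |T| - 1.  The same functional is nonzero at row(v + e_1) for v in F,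
    and this additional point gives dim P = |Q| + |T|. *)

Import Order.TTheory GRing.Theory Num.Theory.

Set Implicit Arguments.
Unset Strict Implicit.

Local Open Scope classical_set_scope.
Local Open Scope ring_scope.

(** * Convex hulls and extreme points *)

Section ConvexHull.
Context {R : realType} {V : vectType R}.
Implicit Types A C : set V.

(** Restates convexity with scalars 0 < t < 1 of R, the form used by
    [extreme_point], in place of the bundled scalars of [convex_set]. *)
Lemma convex_set_combP A :
  convex_set A <-> forall (p q : V) (t : R), A p -> A q -> 0 < t < 1 ->
                     A (t *: p + (1 - t) *: q).
Proof.
split=> [cA p q t Ap Aq /andP[t0 t1]|cA].
  have t01 : Itv.spec (@Itv.num_sem R) (Itv.Real `[0%Z, 1%Z]) t.
    by rewrite /Itv.spec/= /Itv.num_sem/= num_real/= in_itv/= !ltW.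
  have := cA p q (Itv.mk t01); rewrite !inE; exact.
apply/convex_setW => p q; rewrite !inE => Ap Aq t t0 t1; rewrite inE.
by apply: cA => //; rewrite t0.
Qed.

Lemma convex_hull_ind A C :
  (forall (p q : V) (t : R), C p -> C q -> 0 < t < 1 ->
     C (t *: p + (1 - t) *: q)) ->
  A `<=` C -> convex_hull A `<=` C.
Proof. by move=> /convex_set_combP; apply: smallest_sub. Qed.

Lemma sub_convex_hull A : A `<=` convex_hull A.
Proof. exact: sub_smallest. Qed.

Lemma convex_hull_comb A (p q : V) (t : R) :
  convex_hull A p -> convex_hull A q -> 0 < t < 1 ->
  convex_hull A (t *: p + (1 - t) *: q).
Proof.
move=> Ap Aq t01 C [cC AC]; apply: (iffLR (convex_set_combP C)) => //.
- exact: Ap.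
- exact: Aq.
Qed.

Lemma convex_hull_translate A (d : V) :
  (forall p, A p -> A (p + d)) ->
  forall p, convex_hull A p -> convex_hull A (p + d).
Proof.
move=> Ad; pose C : set V := [set p | convex_hull A (p + d)].
apply: (convex_hull_ind (C := C)) => [p q t Pp Pq t01|p Ap]; last first.
  by apply: sub_convex_hull; exact: Ad.
rewrite /C/=; have -> :
    t *: p + (1 - t) *: q + d = t *: (p + d) + (1 - t) *: (q + d).
  by rewrite !scalerDr addrACA -scalerDl subrKC scale1r.
exact: convex_hull_comb.
Qed.

(** The points lexicographically below v form a convex set, so v also dominates
    the whole hull of A.  A segment through v must then have endpoints with
    the same values of g and N as v, which strict convexity of N forbids. *)
Lemma extreme_point_lexmax A (g N : V -> R) (v : V) :
  (forall (p q : V) t, g (t *: p + (1 - t) *: q) = t * g p + (1 - t) * g q) ->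
  (forall (p q : V) t, 0 < t < 1 -> p != q ->
     N (t *: p + (1 - t) *: q) < t * N p + (1 - t) * N q) ->
  A v -> (forall p, A p -> g p < g v \/ g p = g v /\ N p <= N v) ->
  extreme_point (convex_hull A) v.
Proof.
move=> gE Nconv Av vmax; split; first exact: sub_convex_hull.
have hullmax :
    convex_hull A `<=` [set p | g p < g v \/ g p = g v /\ N p <= N v].
  apply: convex_hull_ind => [p q t|p /vmax//] /= Cp Cq t01.
  have Npq : N (t *: p + (1 - t) *: q) <= t * N p + (1 - t) * N q.
    have [->|pq] := eqVneq p q; last exact/ltW/Nconv.
    by rewrite -scalerDl -mulrDl subrKC scale1r mul1r.
  rewrite gE; case/andP: t01 => t0 t1.
  case: Cp => [gp|[gp Np]]; case: Cq => [gq|[gq Nq]].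
  - by left; nra.
  - by left; rewrite gq; nra.
  - by left; rewrite gp; nra.
  - by right; rewrite gp gq; split; [ring|nra].
move=> p q t /hullmax Cp /hullmax Cq t01 vE; apply/eqP/contraT => pq.
have /andP[t0 t1] := t01.
have := Nconv p q t t01 pq; rewrite -vE => Nv.
have := gE p q t; rewrite -vE => gv.
case: Cp => [gp|[gp Np]]; case: Cq => [gq|[gq Nq]]; nra.
Qed.

End ConvexHull.

Lemma lexmax_seq {R : realType} {T : eqType} (g N : T -> R) (s : seq T)
    (x : T) :
  x \in s -> exists2 v, v \in s &
    forall p, p \in s -> g p < g v \/ g p = g v /\ N p <= N v.
Proof.
elim: s x => // y s IH _ _; case: s IH => [_|z s IH].
  by exists y; rewrite ?mem_head// => p; rewrite inE => /eqP ->; right.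
have [v vs vmax] := IH z (mem_head _ _).
have [yv|vy] : (g y < g v \/ g y = g v /\ N y <= N v) \/
               (g v < g y \/ g v = g y /\ N v <= N y).
  have [yv|vy|yv] := ltgtP (g y) (g v).
  - by left; left.
  - by right; left.
  - by have [le|/ltW le] := leP (N y) (N v); [left|right]; right.
- exists v; first by rewrite inE vs orbT.
  by move=> p; rewrite inE => /predU1P[->//|/vmax].
- exists y; first exact: mem_head.
  move=> p; rewrite inE => /predU1P[->|/vmax]; first by right.
  case: vy => [vy|[vy Ny]] [pv|[pv Np]].
  - by left; apply: lt_trans vy.
  - by left; rewrite pv.
  - by left; rewrite -vy.
  - by right; rewrite pv vy; split=> //; apply: le_trans Ny.
Qed.

(** * The scalar product *)

Section Dot.
Context {R : realType} {I : finType}.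
Implicit Types u v w : {ffun I -> R^o}.

Lemma dotC u v : dot u v = dot v u.
Proof. by apply: eq_bigr => i _; rewrite mulrC. Qed.

Lemma dotDl u v w : dot (u + v) w = dot u w + dot v w.
Proof.
by rewrite /dot -big_split; apply: eq_bigr => i _; rewrite ffunE mulrDl.
Qed.

Lemma dotZl k u w : dot (k *: u) w = k * dot u w.
Proof.
by rewrite /dot big_distrr; apply: eq_bigr => i _; rewrite ffunE -scalerAl.
Qed.

Lemma dotNl u w : dot (- u) w = - dot u w.
Proof. by rewrite -scaleN1r dotZl mulN1r. Qed.

Lemma dotDr u v w : dot w (u + v) = dot w u + dot w v.
Proof. by rewrite dotC dotDl !(dotC w). Qed.

Lemma dotZr k u w : dot w (k *: u) = k * dot w u.
Proof. by rewrite dotC dotZl (dotC w). Qed.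

Lemma dot0l w : dot 0 w = 0.
Proof. by rewrite -(scale0r 0) dotZl mul0r. Qed.

Lemma dot0r w : dot w 0 = 0.
Proof. by rewrite dotC dot0l. Qed.

Lemma dot_indicator u i : dot u [ffun j => (j == i)%:R] = u i.
Proof.
rewrite /dot (bigD1 i)//= big1 ?addr0 ?ffunE ?eqxx ?mulr1// => j /negPf ji.
by rewrite ffunE ji mulr0.
Qed.

Lemma dot_ge0 u : 0 <= dot u u.
Proof. by apply: sumr_ge0 => i _; exact: sqr_ge0. Qed.

Lemma dot_eq0 u : dot u u = 0 -> u = 0.
Proof.
move=> u0; apply/ffunP => i; rewrite ffunE; apply/eqP.
rewrite -sqrf_eq0 expr2; have /psumr_eq0P := u0 => -> //.
by move=> j _; exact: sqr_ge0.
Qed.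

(** Quantifies the strict convexity of the squared Euclidean norm. *)
Lemma dot_comb_self u v (t : R) :
  dot (t *: u + (1 - t) *: v) (t *: u + (1 - t) *: v) =
  t * dot u u + (1 - t) * dot v v - t * (1 - t) * dot (u - v) (u - v).
Proof.
by rewrite -(scaleN1r v) !(dotDl, dotDr, dotZl, dotZr) (dotC v u); ring.
Qed.

End Dot.

(** * Validity of feasible inequalities *)

Section FlowArc.
Context {R : realType} {Q : finType} {n : nat}.
Variables (a : {ffun Q -> R^o}) (b : {ffun 'I_n.+1 -> R^o}) (c : R).
Local Notation point := (flow_point R Q n).
Local Notation X := (flow_arc_set a b c).
Local Notation P := (flow_arc_polyhedron a b c).

Definition sqnorm (p : point) : R := dot p.1 p.1 + dot p.2 p.2.

Lemma sqnorm_strictly_convex (p q : point) (t : R) : 0 < t < 1 -> p != q ->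
  sqnorm (t *: p + (1 - t) *: q) < t * sqnorm p + (1 - t) * sqnorm q.
Proof.
move=> /andP[t0 t1] pq; rewrite /sqnorm /= !dot_comb_self.
have d_gt0 : 0 < dot (p.1 - q.1) (p.1 - q.1) + dot (p.2 - q.2) (p.2 - q.2).
  rewrite lt_neqAle addr_ge0 ?dot_ge0// andbT eq_sym.
  rewrite paddr_eq0 ?dot_ge0//; apply: contra pq => /andP[/eqP d1 /eqP d2].
  apply/eqP/injective_projections; apply/eqP; rewrite -subr_eq0; apply/eqP;
  exact: dot_eq0.
have : 0 < t * (1 - t) *
    (dot (p.1 - q.1) (p.1 - q.1) + dot (p.2 - q.2) (p.2 - q.2)).
  by rewrite !mulr_gt0 ?subr_gt0.
lra.
Qed.

(** A lower bound m on the functional bounds each y_t, since beta_t > 0 and x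
    ranges over a finite set; integrality then leaves finitely many points. *)
Lemma flow_arc_bounded (alpha : {ffun Q -> R^o}) (beta : {ffun 'I_n.+1 -> R^o})
    (m : R) : (forall t, 0 < beta t) ->
  exists s : seq point, forall p, X p ->
    m <= dot p.1 alpha - dot p.2 beta -> p \in s.
Proof.
move=> beta_gt0; pose M := `|\sum_q `|alpha q| - m|.
pose K := \max_t Num.bound (M / beta t).
pose pt (z : {ffun Q -> bool} * {ffun 'I_n.+1 -> 'I_K}) : point :=
  ([ffun q => (z.1 q)%:R], [ffun t => (z.2 t)%:R]).
exists [seq pt z | z <- enum predT] => p [x01 ynat _] mp.
have y_ge0 t : 0 <= p.2 t by have /natrP[k ->] := ynat t.
have yK t : p.2 t < K%:R.
  apply: lt_le_trans (_ : (Num.bound (M / beta t))%:R <= _); last first.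
    rewrite ler_nat.
    exact: (leq_bigmax (F := fun t => Num.bound (M / beta t))).
  apply: le_lt_trans (_ : M / beta t < _); last first.
    by apply: archi_boundP; rewrite divr_ge0 ?normr_ge0// ltW.
  rewrite ler_pdivlMr//.
  have xle : dot p.1 alpha <= \sum_q `|alpha q|.
    apply: ler_sum => q _; have := ler_norm (alpha q).
    have := normr_ge0 (alpha q).
    by case: (x01 q) => ->; rewrite ?mul0r ?mul1r.
  have yge : p.2 t * beta t <= dot p.2 beta.
    rewrite /dot (bigD1 t)//= lerDl sumr_ge0// => s _.
    by rewrite mulr_ge0// ltW.
  have := ler_norm (\sum_q `|alpha q| - m); rewrite -/M; lra.
have /choice[k kE] : forall t, exists k : 'I_K, p.2 t = k%:R.
  move=> t; have /natrP[k kE] := ynat t; have := yK t.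
  by rewrite kE ltr_nat => kK; exists (Ordinal kK).
apply/mapP; exists ([ffun q => p.1 q == 1], finfun k).
  by rewrite mem_enum.
apply: injective_projections; apply/ffunP => i; rewrite !ffunE/= ?ffunE//.
by case: (x01 i) => ->; rewrite ?eqxx// eq_sym oner_eq0.
Qed.

(** The vertex is a lexicographic maximizer, over X, of the functional and then
    of the norm; the norm picks an extreme point among the maximizers. *)
Lemma dominating_vertex (alpha : {ffun Q -> R^o})
    (beta : {ffun 'I_n.+1 -> R^o}) (p : point) :
  (forall t, 0 < beta t) -> X p ->
  exists2 v, extreme_point P v &
    dot p.1 alpha - dot p.2 beta <= dot v.1 alpha - dot v.2 beta.
Proof.
move=> beta_gt0 Xp; pose g (q : point) := dot q.1 alpha - dot q.2 beta.
have [s sP] := flow_arc_bounded alpha (g p) beta_gt0.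
have Xs q : X q -> g p <= g q -> q \in [seq q <- s | `[< X q >]].
  by move=> Xq pq; rewrite mem_filter sP// andbT; exact/asboolP.
have [v] := lexmax_seq g sqnorm (Xs p Xp (lexx _)).
rewrite mem_filter => /andP[/asboolP Xv vs] vmax.
have pv : g p <= g v by have [/ltW|[->]] := vmax p (Xs p Xp (lexx _)).
exists v => //; apply: (@extreme_point_lexmax _ _ _ g sqnorm) => //.
- by move=> q r t; rewrite /g /= !(dotDl, dotZl); ring.
- exact: sqnorm_strictly_convex.
- move=> q Xq; have [pq|qp] := leP (g p) (g q).
    exact/vmax/Xs.
  by left; exact: lt_le_trans pv.
Qed.

(** Perturbing beta by eps makes [dominating_vertex] applicable.  The vertex v
    that it yields depends on eps, but v satisfies the unperturbed constraint
    and has y >= 0, so the value at p exceeds gamma by at most eps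
    times the sum of the y_t of p, for every eps > 0. *)
Lemma lp_feasible_valid (alpha : {ffun Q -> R^o})
    (beta : {ffun 'I_n.+1 -> R^o}) (gamma : R) :
  lp_feasible P alpha beta gamma -> valid_inequality P alpha beta gamma.
Proof.
move=> [vertex_le beta0 beta_ge0].
have {}beta_ge0 t : 0 <= beta t.
  by have [->|/beta_ge0//] := eqVneq t ord0; rewrite beta0.
suff XC : X `<=` [set p : point | dot p.1 alpha - dot p.2 beta <= gamma].
  have := convex_hull_ind _ XC => /(_ _) PC p /PC.
  rewrite /= (dotC alpha) (dotC beta) lerBlDl; apply.
  move=> q r t /= Cq Cr /andP[t0 t1]; rewrite !(dotDl, dotZl); nra.
move=> p Xp /=; rewrite leNgt; apply/negP => gamma_lt.
pose one : {ffun 'I_n.+1 -> R^o} := [ffun _ => 1].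
have y_ge0 : 0 <= dot p.2 one.
  apply: sumr_ge0 => t _; rewrite ffunE mulr1.
  by case: Xp => _ /(_ t) /natrP[k ->].
(* eps times the sum of the y_t of p is less than the excess over gamma *)
pose eps := (dot p.1 alpha - dot p.2 beta - gamma) / (dot p.2 one + 1).
have y1_gt0 : 0 < dot p.2 one + 1 by lra.
have eps_gt0 : 0 < eps by rewrite divr_gt0 ?subr_gt0.
have [|v Pv pv] := @dominating_vertex alpha (beta + eps *: one) p _ Xp.
  move=> t; rewrite ffunE (_ : (eps *: one) t = eps).
    exact: ltr_wpDl.
  by rewrite !ffunE; exact: mulr1.
have vy_ge0 : 0 <= dot v.2 one.
  have : P `<=` [set q : point | 0 <= dot q.2 one].
    apply: convex_hull_ind => [q r t /= q0 r0 /andP[t0 t1]|q [_ qnat _] /=].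
      by rewrite dotDl !dotZl; nra.
    apply: sumr_ge0 => t _; rewrite ffunE mulr1.
    by have /natrP[k ->] := qnat t.
  by apply; case: Pv.
have := vertex_le v Pv; move: pv; rewrite !dotDr !dotZr => pv vle.
have epsE : eps * (dot p.2 one + 1) = dot p.1 alpha - dot p.2 beta - gamma.
  by rewrite divfK// gt_eqF.
have := mulr_ge0 (ltW eps_gt0) vy_ge0; lra.
Qed.
End FlowArc.

(** * Affine independence and constraint rows *)

Lemma exists_free_sub {K : fieldType} {V : vectType K} {T : eqType} (f : T -> V)
    (s : seq T) :
  exists r : seq T, [/\ {subset r <= s}, free (map f r) &
                        <<map f r>>%VS = <<map f s>>%VS].
Proof.
elim: s => [|x s [r [rs fr spanr]]]; first by exists [::]; rewrite nil_free.
have [xr|xr] := boolP (f x \in <<map f r>>%VS).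
  exists r; split=> [y /rs|//|]; first by rewrite inE orbC => ->.
  rewrite /= span_cons -spanr; apply/esym/addv_idPr; exact: xr.
exists (x :: r); split; last by rewrite /= !span_cons spanr.
  by move=> y; rewrite !inE => /predU1P[->|/rs ->]; rewrite ?eqxx ?orbT.
by rewrite /= free_cons xr.
Qed.

Section Rows.
Context {R : realType} {Q : finType} {n : nat}.
Local Notation point := (flow_point R Q n).
Local Notation lpv := (lp_vector R Q n).

Definition lp_row (v : point) : lpv := (v.1, - v.2, -1).

Definition lp_ray (t : 'I_n.+1) : lpv := (0, [ffun s => (s == t)%:R], 0).

Lemma dim_lp_vector : \dim {:lpv} = (#|Q| + n.+1 + 1)%N.
Proof.
by rewrite dimvf -[LHS]/(#|Q| * 1 + #|'I_n.+1| * 1 + 1)%N !muln1 card_ord.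
Qed.

Lemma sum_lp_row (s : seq point) (k : 'I_(size s) -> R) :
  \sum_i k i *: lp_row s`_i =
  ((\sum_i k i *: s`_i).1, - (\sum_i k i *: s`_i).2, - \sum_i k i).
Proof.
elim/big_rec3: _ => [|i sk sv sr _ ->]; first by rewrite !oppr0.
rewrite /lp_row /=; congr (_, _, _) => /=.
- by rewrite scalerN opprD.
- by rewrite opprD -[_ *: -1]/(_ * -1) mulrN1.
Qed.

(** Up to sign changes, [lp_row] embeds the points in the hyperplane of height 1,
    which turns affine dependences into linear ones. *)
Lemma affinely_independent_row (s : seq point) :
  affinely_independent s <-> free (map lp_row s).
Proof.
have tE : map lp_row s = map_tuple lp_row (in_tuple s) by [].
have rE (k : 'I_(size s) -> R) :
    \sum_i k i *: (map lp_row s)`_i = \sum_i k i *: lp_row s`_i.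
  by apply: eq_bigr => i _; rewrite (nth_map 0).
split=> [sI|].
  rewrite tE; apply/freeP => k; rewrite rE sum_lp_row => -[].
  move=> k1 /eqP; rewrite oppr_eq0 => /eqP k2 /eqP; rewrite oppr_eq0 => /eqP k3.
  by apply: sI => //; apply: injective_projections.
rewrite tE => /freeP sF k sk k0; apply: sF; rewrite rE sum_lp_row sk k0.
by rewrite !oppr0.
Qed.

Variables (alpha : {ffun Q -> R^o}) (beta : {ffun 'I_n.+1 -> R^o}) (gamma : R).

(** The left-hand side, at the fixed point (alpha, beta, gamma), of the
    constraint whose coefficient vector is w. *)
Definition lp_lhs (w : lpv) : R^o :=
  dot w.1.1 alpha + dot w.1.2 beta + w.2 * gamma.

Lemma lp_lhs_is_linear : linear lp_lhs.
Proof.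
move=> k u v; rewrite /lp_lhs/= !(dotDl, dotZl) /GRing.scale/=; ring.
Qed.

HB.instance Definition _ :=
  GRing.isLinear.Build R lpv R^o _ lp_lhs lp_lhs_is_linear.

Lemma lp_lhs_row v : lp_lhs (lp_row v) = dot v.1 alpha - dot v.2 beta - gamma.
Proof. by rewrite /lp_lhs/= dotNl mulN1r. Qed.

Lemma lp_lhs_ray t : lp_lhs (lp_ray t) = beta t.
Proof.
by rewrite /lp_lhs/= (dotC _ beta) dot_indicator mul0r addr0 dot0l add0r.
Qed.

Lemma lp_lhs_span (s : seq lpv) w :
  (forall u, u \in s -> lp_lhs u = 0) -> w \in <<s>>%VS -> lp_lhs w = 0.
Proof.
move=> s0; have sker : (<<s>> <= lker (linfun lp_lhs))%VS.
  by apply/span_subvP => u /s0 u0; rewrite memv_ker lfunE/= u0.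
by move=> /(subvP sker); rewrite memv_ker lfunE => /eqP.
Qed.

(** The functional [lp_lhs] separates the ray t, and the row of v0, from the span
    of the rows of F.  So either vector can be added to a free family of rows of
    F: the ray to bound the dimension of F, the point v0 to gain one for P. *)
Lemma facet_dimensions (P F : set point) (q : seq point) (t : 'I_n.+1) v0 :
  P v0 -> F `<=` P -> lp_lhs (lp_row v0) != 0 ->
  (forall v, F v -> lp_lhs (lp_row v) = 0) -> beta t != 0 ->
  [set` q] `<=` F -> (<[lp_ray t]> + <<map lp_row q>>)%VS = fullv ->
  has_dim P (#|Q| + n.+1)%N%:Z /\ has_dim F ((#|Q| + n.+1)%N%:Z - 1).
Proof.
move=> Pv0 FP v0N F0 betat qF qfull.
have free_le (s : seq lpv) : free s -> (size s <= (#|Q| + n.+1).+1)%N.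
  by move=> /eqP <-; rewrite -[leqRHS]addn1 -dim_lp_vector; exact/dimvS/subvf.
have notin (s : seq point) w : [set` s] `<=` F -> lp_lhs w != 0 ->
    w \notin <<map lp_row s>>%VS.
  move=> sF; apply: contraNN => ws; apply/eqP/(lp_lhs_span _ ws).
  by move=> _ /mapP[v vs ->]; apply: F0; exact: sF.
have [r [rq rfree rspan]] := exists_free_sub lp_row q.
have rF : [set` r] `<=` F by move=> v /= /rq; exact: qF.
have size_r : size r = (#|Q| + n.+1)%N.
  have /andP[/eqP rfull /eqP] : basis_of fullv (lp_ray t :: map lp_row r).
    rewrite /basis_of span_cons rspan qfull eqxx free_cons rfree.
    by rewrite notin ?lp_lhs_ray.
  by rewrite rfull dim_lp_vector/= size_map addn1 => -[].
split; split.
- exists (v0 :: r); split; last by rewrite /= size_r intS addrC.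
    by apply/affinely_independent_row; rewrite /= free_cons rfree notin.
  by move=> v /=; rewrite inE => /predU1P[->//|vr]; exact/FP/rF.
- move=> s /affinely_independent_row/free_le; rewrite size_map => sle _.
  by rewrite addrC -intS lez_nat.
- exists r; split=> //; first exact/affinely_independent_row.
  by rewrite size_r subrK.
- move=> s /affinely_independent_row sfree sF; rewrite subrK lez_nat.
  have := @free_le (lp_ray t :: map lp_row s).
  by rewrite free_cons sfree notin ?lp_lhs_ray//= size_map; apply.
Qed.

End Rows.

(** * Active constraints and the induced face *)

Section Facet.
Context {R : realType} {Q : finType} {n : nat}.
Variables (a : {ffun Q -> R^o}) (b : {ffun 'I_n.+1 -> R^o}) (c : R).
Local Notation point := (flow_point R Q n).
Local Notation P := (flow_arc_polyhedron a b c).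

Definition unit_flow (t : 'I_n.+1) : point := (0, [ffun s => (s == t)%:R]).

Lemma lp_row_unit_flow (v : point) t :
  lp_row (v + unit_flow t) = lp_row v - lp_ray t.
Proof. by congr (_, _, _); rewrite /= ?opprD ?subr0 ?addr0. Qed.

Lemma flow_arc_unit_flow (v : point) t :
  (forall s, 0 <= b s) -> P v -> P (v + unit_flow t).
Proof.
move=> b_ge0; apply: convex_hull_translate => {}v [x01 ynat xy].
split=> [i|s|] /=.
- by rewrite ffunE ffunE addr0.
- by rewrite !ffunE rpredD// natr_nat.
- by rewrite !dotDr dot_indicator dot0r addr0; have := b_ge0 t; lra.
Qed.

Variables (alpha : {ffun Q -> R^o}) (beta : {ffun 'I_n.+1 -> R^o}) (gamma : R).
Local Notation F := (induced_face P alpha beta gamma).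
Local Notation lhs := (lp_lhs alpha beta gamma).

Lemma induced_faceE (v : point) : F v <-> P v /\ lhs (lp_row v) = 0.
Proof.
rewrite /induced_face/= lp_lhs_row (dotC alpha) (dotC beta).
by split=> -[Pv e]; split=> //; [rewrite e|]; lra.
Qed.

(** A row of a tight vertex is the row of a point of F.  An active constraint
    beta_t >= 0 makes e_t a direction of F, so that the ray t is the difference
    of the rows of v1 and v1 + e_t. *)
Lemma active_subset_face_span (v1 : point) (s : seq (lp_vector R Q n)) :
  (forall t, 0 <= b t) -> F v1 -> [set` s] `<=` lp_active P alpha beta gamma ->
  exists2 q : seq point, [set` q] `<=` F &
    (<<s>> <= <[lp_ray ord0]> + <<map lp_row q>>)%VS.
Proof.
move=> b_ge0 Fv1; elim: s => [_|w s IH ws].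
  by exists [::] => //; rewrite span_nil sub0v.
have [|q qF sq] := IH; first by move=> u us; apply: ws; rewrite /= inE us orbT.
suff [q' q'F wq] : exists2 q' : seq point, [set` q'] `<=` F &
    w \in (<[lp_ray ord0]> + <<map lp_row q'>>)%VS.
  exists (q' ++ q).
    by move=> v /=; rewrite mem_cat => /orP[/q'F|/qF].
  rewrite span_cons map_cat span_cat subv_add -memvE; apply/andP; split.
    by move: wq; apply/subvP/addvS => //; exact: addvSl.
  by apply: subv_trans sq _; apply/addvS => //; exact: addvSr.
have [[[v [Pv v0] <-]| ->]|[t [_ t0] <-]] := ws w (mem_head w s).
- exists [:: v].
    move=> u /=; rewrite inE => /eqP ->; apply/induced_faceE.
    by rewrite lp_lhs_row; split=> //; case: Pv.
  by rewrite (subvP (addvSr _ _))// memv_span// mem_head.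
- by exists [::] => //; rewrite (subvP (addvSl _ _))// memv_line.
- exists [:: v1; v1 + unit_flow t].
    move=> u /=; rewrite !inE => /pred2P[->//| ->]; apply/induced_faceE.
    have [Pv1 v10] := iffLR (induced_faceE v1) Fv1.
    split; first exact: flow_arc_unit_flow.
    by rewrite lp_row_unit_flow linearB/= lp_lhs_ray v10 t0 subr0.
  rewrite (subvP (addvSr _ _))// -/(lp_ray t) -(subKr (lp_row v1) (lp_ray t)).
  by rewrite -lp_row_unit_flow rpredB// memv_span// !inE eqxx ?orbT.
Qed.

(** Without a tight vertex all active vectors would have a zero gamma-coordinate,
    and so could not span the whole space. *)
Lemma basic_active_vertex :
  has_rank (lp_active P alpha beta gamma) (#|Q| + n.+1 + 1) -> exists v, F v.
Proof.
case=> -[s [sfree sact size_s]] _; apply: contrapT => noF.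
(* lp_lhs 0 0 1 is the gamma-coordinate *)
have s0 : forall w, w \in s -> lp_lhs 0 0 1 w = 0.
  move=> w /sact [[[v [Pv v0] _]| ->]|[t _ <-]].
  - case: noF; exists v; apply/induced_faceE; rewrite lp_lhs_row.
    by split=> //; case: Pv.
  - by rewrite (lp_lhs_ray _ _ _ ord0) ffunE.
  - by rewrite (lp_lhs_ray _ _ _ t) ffunE.
have sfull : <<s>>%VS = fullv.
  apply/eqP; rewrite eqEdim subvf dim_lp_vector -size_s.
  by move/eqP: sfree => ->/=.
have := lp_lhs_span s0 (w := lp_row 0); rewrite sfull memvf => /(_ isT).
by rewrite lp_lhs_row !dot0r; lra.
Qed.

Lemma basic_feasible_facet :
  (forall t, 0 <= b t) ->
  lp_feasible P alpha beta gamma ->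
  has_rank (lp_active P alpha beta gamma) (#|Q| + n.+1 + 1) ->
  facet_defining P alpha beta gamma.
Proof.
move=> b_ge0 feas act; have [v1 Fv1] := basic_active_vertex act.
split; [exact: lp_feasible_valid|by exists v1|].
have [[s [sfree sact size_s]] _] := act.
have [q qF sq] := active_subset_face_span b_ge0 Fv1 sact.
have [_ beta0 _] := feas; have [Pv1 v10] := iffLR (induced_faceE v1) Fv1.
exists (#|Q| + n.+1)%N%:Z.
(* since beta_1 = 1, the point v1 + e_1 of P is off the face *)
apply: (@facet_dimensions _ _ _ alpha beta gamma _ _ q ord0
          (v1 + unit_flow ord0)) => //.
- exact: flow_arc_unit_flow.
- by move=> v [].
- rewrite lp_row_unit_flow linearB/= lp_lhs_ray v10 beta0.
  by rewrite sub0r oppr_eq0 oner_eq0.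
- by move=> v /induced_faceE[].
- by rewrite beta0 oner_eq0.
- apply/eqP; rewrite eqEsubv subvf/=; apply: subv_trans sq.
  rewrite -(geq_leqif (dimv_leqif_sup (subvf _))) dim_lp_vector -size_s.
  by move/eqP: sfree => ->.
Qed.

End Facet.

Theorem theorem1 (R : realType) (Q : finType) (n : nat)
  (a : {ffun Q -> R^o}) (b : {ffun 'I_n.+1 -> R^o}) (c : R)
  (a_gt0 : forall q : Q, 0 < a q)
  (b1_gt0 : 0 < b ord0)
  (b_nondecreasing : forall s t : 'I_n.+1, (s <= t)%N -> b s <= b t)
  (ac_gt0 : 0 < \sum_(q : Q) a q - c)
  (pbar : flow_point R Q n) (pbar_LP : flow_arc_relaxation a b c pbar)
  (alpha : {ffun Q -> R^o}) (beta : {ffun 'I_n.+1 -> R^o}) (gamma : R)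
  (basic_opt :
     lp_basic_optimal (flow_arc_polyhedron a b c) pbar alpha beta gamma) :
  facet_defining (flow_arc_polyhedron a b c) alpha beta gamma.
Proof.
have [[feas _] rank] := basic_opt.
apply: basic_feasible_facet => // t.
by apply: le_trans (ltW b1_gt0) _; exact: b_nondecreasing.
Qed.
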